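(* Let $r,s\in\mathbb{N}$ with $r<s$ and let $\mathcal{A}=\{r,s\}$. Let $z\in\mathcal{A}^{\mathbb{N}}$ be a Kolakoski sequence over $\mathcal{A}$. Then: (1) $z$ is not eventually periodic, i.e., there do not exist $m,q\in\mathbb{N}$ such that $z_{i+1}\ldots z_{i+q}=z_{i+q+1}\ldots z_{i+2q}$ for all $i\ge m$. (2) If $z$ is mirror invariant, then $z$ is recurrent, i.e., every word that occurs in $z$ occurs in $z$ infinitely often. (3) $z$ is mirror invariant if and only if every $C^{\infty}$-word over $\mathcal{A}$ occurs in $z$.
   Context: A run in a (finite or infinite) word is a maximal subword consisting of identical letters. A one-sided infinite sequence $z\in\{r,s\}^{\mathbb{N}}$ is a Kolakoski sequence over $\{r,s\}$ if the sequence of lengths of its consecutive runs equals $z$ itself. For a word $w=w_1\ldots w_n$, $\tilde{w}=\tilde{w}_1\ldots\tilde{w}_n$ where $\tilde{r}=s$, $\tilde{s}=r$. A sequence $z$ is mirror invariant if for every word $w$: $w$ occurs in $z$ iff $\tilde{w}$ occurs in $z$. Derivative: for a word $w$ over $\{r,s\}$ (with $r<s$), $D(w)$ is defined as follows. $D(\varepsilon)=\varepsilon$ ($\varepsilon$ the empty word). If $w$ is a single run of length less than $s$, then $D(w)=\varepsilon$. Otherwise, alter $w$ as follows: if the first (respectively last) run of $w$ has length at most $r$, delete it; if it has length between $r+1$ and $s$, extend it to a run of length exactly $s$; then $D(w)$ is the sequence of run lengths of the altered word (possibly empty). A word $w$ is differentiable if $D(w)$ is again a word over $\{r,s\}$ (possibly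 empty), and $w$ is a $C^{\infty}$-word if $D^k(w)$ is a word over $\{r,s\}$ for every $k\ge 0$. (Example over $\{2,5\}$: $D(255555222)=55$, $D(2222)=\varepsilon$, $D(25555552)=6$ is not over the alphabet.) *)

(* Defs.v *)
From mathcomp Require Import all_boot.

Set Implicit Arguments.
Unset Strict Implicit.
Unset Printing Implicit Defensive.

(* Letters are natural numbers.  Finite words are [seq nat]; an infinite word
   z_1 z_2 ... is a function [z : nat -> nat] with z_(i+1) given by [z i]. *)

Definition word_over (r s : nat) (w : seq nat) : bool := all (pred2 r s) w.

Definition factor (z : nat -> nat) (i n : nat) : seq nat :=
  [seq z j | j <- iota i n].

Definition occurs_at (z : nat -> nat) (w : seq nat) (i : nat) : Prop :=
  factor z i (size w) = w.

Definition occurs (z : nat -> nat) (w : seq nat) : Prop :=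
  exists i, occurs_at z w i.

(* The third condition says that the run cannot be extended to the right, the
   last one that it cannot be extended to the left. *)
Definition is_run (z : nat -> nat) (a n : nat) : Prop :=
  [/\ 0 < n,
      forall j, j < n -> z (a + j) = z a,
      z (a + n) <> z a &
      0 < a -> z a.-1 <> z a].

(* The k-th run (k >= 0) starts where the previous runs end.  In particular
   every run of [z] is finite. *)
Definition has_run_lengths (z l : nat -> nat) : Prop :=
  forall k, is_run z (\sum_(j < k) l j) (l k).

Definition kolakoski (r s : nat) (z : nat -> nat) : Prop :=
  (forall i, pred2 r s (z i)) /\ has_run_lengths z z.

Definition eventually_periodic (z : nat -> nat) : Prop :=
  exists m q, 0 < q /\ forall i, m <= i -> factor z i q = factor z (i + q) q.

Definition recurrent (z : nat -> nat) : Prop :=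
  forall w, occurs z w -> forall n, exists2 i, n <= i & occurs_at z w i.

(* Only ever used on the letters [r] and [s]; other letters are left fixed. *)
Definition mirror_letter (r s x : nat) : nat :=
  if x == r then s else if x == s then r else x.

Definition mirror (r s : nat) (w : seq nat) : seq nat :=
  map (mirror_letter r s) w.

Definition mirror_invariant (r s : nat) (z : nat -> nat) : Prop :=
  forall w, word_over r s w -> (occurs z w <-> occurs z (mirror r s w)).

(* The runs of a finite word, from left to right; their concatenation is the
   word itself. *)
Fixpoint runs (w : seq nat) : seq (seq nat) :=
  if w is x :: w' then
    match runs w' with
    | (y :: u) :: us =>
        if x == y then (x :: y :: u) :: us else [:: x] :: (y :: u) :: us
    | _ => [:: [:: x]]
    end
  else [::].

Definition run_lengths (w : seq nat) : seq nat := map size (runs w).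

Definition alter_run (r s : nat) (u : seq nat) : seq nat :=
  if size u <= r then [::]
  else if size u <= s then nseq s (head 0 u)
  else u.

(* [alter_run] is applied to the first and to the last run of the original
   word [w]; a run that becomes outermost after a deletion is left as it is. *)
Definition alter (r s : nat) (w : seq nat) : seq nat :=
  let us := runs w in
  flatten (mkseq (fun i => let u := nth [::] us i in
                           if (i == 0) || (i == (size us).-1)
                           then alter_run r s u else u)
                 (size us)).

(* The derivative is a total function on words over [nat], so that its
   iterates make sense even when a derivative leaves the alphabet {r, s}. *)
Definition D (r s : nat) (w : seq nat) : seq nat :=
  if w == [::] then [::]
  else if (size (runs w) == 1) && (size w < s) then [::]
  else run_lengths (alter r s w).

Definition Cinfty (r s : nat) (w : seq nat) : Prop :=
  forall k, word_over r s (iter k (D r s) w).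

(* Main.v *)
Require Import Defs.
From mathcomp Require Import all_boot zify.

(** (1) If a tail of z has period q, then from the start of some run on the run
    lengths repeat with period the number of runs in q consecutive letters.
    Starting at a run of length s > 1, this number is less than q; but the run
    lengths are z itself, so the period descends indefinitely.

    (2) By mirror invariance the mirror of a prefix p of z occurs in z, and not
    at 0.  Mirroring a prefix that contains this occurrence shows that p itself
    occurs again; hence so does every word, arbitrarily far to the right.

    (3) The derivative of a factor of z is a factor of z, and D does not see
    the mirror: this is the "if" part.  Conversely D shortens words, so by
    induction D w occurs in z, and by (2) not only at the beginning.  Reading
    that occurrence as run lengths yields w or its mirror, where a deleted
    outer run fits in a neighbouring run of z because all runs of z have
    length at least r. *)

Set Implicit Arguments.
Unset Strict Implicit.
Unset Printing Implicit Defensive.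

(** * Factors, occurrences and the mirror map *)

Lemma size_factor z i n : size (factor z i n) = n.
Proof. by rewrite size_map size_iota. Qed.

Lemma factorD z i m n : factor z i (m + n) = factor z i m ++ factor z (i + m) n.
Proof. by rewrite /factor iotaD map_cat. Qed.

Lemma factorS z i n : factor z i n.+1 = z i :: factor z i.+1 n.
Proof. by []. Qed.

Lemma factor_const z x i n :
  (forall j, j < n -> z (i + j) = x) -> factor z i n = nseq n x.
Proof.
elim: n i => [|n IHn] i zx //; rewrite factorS -[i in z i]addn0 zx //=.
by rewrite IHn // => j ltjn; rewrite addSnnS zx.
Qed.

Lemma occurs_cat z u v w i :
  occurs_at z (u ++ v ++ w) i -> occurs_at z v (i + size u).
Proof.
rewrite /occurs_at !size_cat !factorD => /eqP.
by rewrite eqseq_cat ?size_factor // eqseq_cat ?size_factor // => /and3P[_ /eqP].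
Qed.

Lemma occurs_at_prefix z w n i j :
  occurs_at z w i -> i + size w <= n -> occurs_at z (factor z 0 n) j ->
  occurs_at z w (j + i).
Proof.
move=> wi le_n.
have -> : factor z 0 n =
    factor z 0 i ++ w ++ factor z (i + size w) (n - (i + size w)).
  by rewrite -{1}(subnKC le_n) !factorD add0n wi catA.
by move/occurs_cat; rewrite size_factor.
Qed.

(** Applied to run lengths, the cases are those that [D] treats differently: no run, a single run,
    and distinct first and last runs. *)
Lemma seq_outer T (ls : seq T) :
  [\/ ls = [::], exists l, ls = [:: l] | exists l mid l', ls = l :: rcons mid l'].
Proof.
case: ls => [|l ls]; first by constructor 1.
case/lastP: ls => [|mid l']; first by constructor 2; exists l.
by constructor 3; exists l, mid, l'.
Qed.

Lemma mirror_letterK r s : involutive (mirror_letter r s).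
Proof.
move=> x; rewrite /mirror_letter; case: (eqVneq x r) => [->|xr].
  by rewrite eqxx; case: eqVneq.
by case: (eqVneq x s) => [->|xs]; rewrite ?eqxx // (negPf xr) (negPf xs).
Qed.

Lemma mirrorK r s : involutive (mirror r s).
Proof. exact/mapK/mirror_letterK. Qed.

(** The position of the first letter of run [k] when [z] lists its own run lengths. *)
Definition start (z : nat -> nat) (k : nat) : nat := \sum_(j < k) z j.

Lemma startS z k : start z k.+1 = start z k + z k.
Proof. exact: big_ord_recr. Qed.

(** * The two letters *)

Section TwoLetters.

Variables r s : nat.
Hypothesis r_gt0 : 0 < r.
Hypothesis r_lt_s : r < s.

Notation letter := (pred2 r s).
Notation bar := (mirror_letter r s).

Lemma letter_mirror x : letter x -> letter (bar x).
Proof.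
by rewrite /mirror_letter /=; case/orP=> /eqP->; rewrite !eqxx ?orbT //;
  case: ifP; rewrite eqxx ?orbT.
Qed.

Lemma letter_mirror_neq x : letter x -> bar x != x.
Proof.
rewrite /mirror_letter /=; case/orP=> /eqP->; rewrite !eqxx.
  by rewrite gtn_eqF.
by rewrite (gtn_eqF r_lt_s) ltn_eqF.
Qed.

Lemma letter_neqE x y : letter x -> letter y -> x != y -> x = bar y.
Proof.
rewrite /mirror_letter /=.
by do 2![case/orP=> /eqP->]; rewrite ?eqxx // (gtn_eqF r_lt_s).
Qed.

Lemma letter_ge x : letter x -> r <= x.
Proof. by case/orP=> /eqP->; rewrite // ltnW. Qed.

Lemma letter_le x : letter x -> x <= s.
Proof. by case/orP=> /eqP->; rewrite // ltnW. Qed.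

(** * Words given by a first letter and run lengths *)

(** Over two letters the runs alternate, so a word amounts to its first letter [x] and its run
    lengths [ls]; derivatives are computed on [ls]. *)
Fixpoint build (x : nat) (ls : seq nat) : seq nat :=
  if ls is l :: ls' then nseq l x ++ build (bar x) ls' else [::].

Fixpoint build_runs (x : nat) (ls : seq nat) : seq (seq nat) :=
  if ls is l :: ls' then nseq l x :: build_runs (bar x) ls' else [::].

Definition flip (n x : nat) : nat := iter n bar x.

Lemma build_runs_flatten x ls : flatten (build_runs x ls) = build x ls.
Proof. by elim: ls x => //= l ls IHls x; rewrite IHls. Qed.

Lemma size_build_runs x ls : size (build_runs x ls) = size ls.
Proof. by elim: ls x => //= l ls IHls x; rewrite IHls. Qed.

Lemma build_runs_size x ls : map size (build_runs x ls) = ls.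
Proof. by elim: ls x => //= l ls IHls x; rewrite IHls size_nseq. Qed.

Lemma build_cat x ls ls' :
  build x (ls ++ ls') = build x ls ++ build (flip (size ls) x) ls'.
Proof.
by elim: ls x => //= l ls IHls x; rewrite IHls catA /flip -iterSr.
Qed.

Lemma build_runs_cat x ls ls' :
  build_runs x (ls ++ ls') =
  build_runs x ls ++ build_runs (flip (size ls) x) ls'.
Proof. by elim: ls x => //= l ls IHls x; rewrite IHls /flip -iterSr. Qed.

Lemma size_build x ls : size (build x ls) = sumn ls.
Proof. by elim: ls x => //= l ls IHls x; rewrite size_cat size_nseq IHls. Qed.

Lemma word_over_build x ls : letter x -> word_over r s (build x ls).
Proof.
elim: ls x => //= l ls IHls x xA; rewrite /word_over all_cat all_nseq /= xA orbT.
exact/IHls/letter_mirror.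
Qed.

Lemma mirror_build x ls : mirror r s (build x ls) = build (bar x) ls.
Proof.
by elim: ls x => //= l ls IHls x; rewrite [LHS]map_cat map_nseq -[map _ _]/(mirror r s _) IHls.
Qed.

(** Consecutive blocks carry different letters and none is empty, so no two of them merge. *)
Lemma runs_build x ls :
  letter x -> all (leq 1) ls -> runs (build x ls) = build_runs x ls.
Proof.
elim: ls x => //= -[|l] // ls IHls x xA /= ls_gt0.
have := IHls _ (letter_mirror xA) ls_gt0.
elim: l => [|l IHl] runsE /=; last by rewrite IHl //= eqxx.
rewrite runsE; case: ls ls_gt0 {IHls runsE} => [|[|l] ls] //= _.
by rewrite eq_sym (negPf (letter_mirror_neq xA)).
Qed.

Lemma run_lengths_build x ls :
  letter x -> all (leq 1) ls -> run_lengths (build x ls) = ls.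
Proof. by move=> xA ?; rewrite /run_lengths runs_build // build_runs_size. Qed.

Lemma word_over_buildP w : word_over r s w ->
  exists x ls, [/\ letter x, all (leq 1) ls & w = build x ls].
Proof.
elim: w => [_|a w IHw /= /andP[aA /IHw[x [ls [xA ls_gt0 ->]]]]].
  by exists r, [::]; rewrite /= eqxx.
case: ls ls_gt0 => [_|l ls /= /andP[l_gt0 ls_gt0]].
  by exists a, [:: 1].
(* The new letter either lengthens the first run or opens a run of length 1. *)
have [->|xDa] := eqVneq a x.
  by exists x, (l.+1 :: ls); split.
exists a, [:: 1, l & ls]; split; rewrite /= ?l_gt0 //.
by rewrite (letter_neqE aA xA xDa) mirror_letterK.
Qed.

(** * The derivative in terms of run lengths *)

(* The contribution to D of an outermost run of length [l]. *)
Definition cut (l : nat) : seq nat :=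
  if l <= r then [::] else if l <= s then [:: s] else [:: l].

Lemma cut_gt0 l : all (leq 1) (cut l).
Proof. by rewrite /cut; do 2![case: leqP => //= ?]; rewrite andbT; lia. Qed.

Lemma size_cut l : 0 < l -> size (cut l) < l.
Proof. by rewrite /cut; case: (leqP l r) => //= ?; case: (leqP l s) => /=; lia. Qed.

Lemma alter_nseq l x : alter_run r s (nseq l x) = build x (cut l).
Proof.
rewrite /alter_run /cut size_nseq; case: leqP => //= ltrl.
by rewrite -(ltn_predK ltrl); case: leqP => _; rewrite /= cats0.
Qed.

Lemma alter_outer w u mid v : runs w = u :: rcons mid v ->
  alter r s w = alter_run r s u ++ flatten mid ++ alter_run r s v.
Proof.
rewrite /alter => ->; set us := u :: _.
rewrite -flatten_rcons -[RHS]/(flatten (_ :: _)); congr flatten.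
apply: (@eq_from_nth _ [::]) => [|i].
  by rewrite size_mkseq /us /= !size_rcons.
rewrite size_mkseq => lti; rewrite nth_mkseq //.
case: i lti => [|i] //=; rewrite /us /= !size_rcons !ltnS eqSS !nth_rcons => lei.
by case: ltngtP lei.
Qed.

(** The only run is both first and last, but [alter] changes it once; for [s <= l] this keeps its
    length. *)
Lemma D_build1 x l : letter x -> 0 < l ->
  D r s (build x [:: l]) = if l < s then [::] else [:: l].
Proof.
move=> xA l_gt0; have l_pos : all (leq 1) [:: l] by rewrite /= l_gt0.
rewrite /D -size_eq0 size_build runs_build // size_build_runs /= addn0.
rewrite (gtn_eqF l_gt0); case: ltnP => //= lesl.
have -> : alter r s (build x [:: l]) = build x [:: l]; last first.
  by rewrite run_lengths_build.
rewrite /alter runs_build //= cats0 alter_nseq /cut.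
case: leqP => [|_]; first by lia.
by case: leqP => [?|_]; rewrite /= ?cats0 //; congr nseq; lia.
Qed.

Lemma D_build2 x l mid l' : letter x -> all (leq 1) (l :: rcons mid l') ->
  D r s (build x (l :: rcons mid l')) = cut l ++ mid ++ cut l'.
Proof.
move=> xA ls_gt0; have /and3P[l_gt0 l'_gt0 mid_gt0] : [&& 0 < l, 0 < l' & all (leq 1) mid].
  by move: ls_gt0; rewrite /= all_rcons.
rewrite /D -size_eq0 size_build runs_build // size_build_runs /=.
rewrite size_rcons addn_eq0 (gtn_eqF l_gt0) /=.
have runsE : runs (build x (l :: rcons mid l')) =
    nseq l x :: rcons (build_runs (bar x) mid) (nseq l' (flip (size mid) (bar x))).
  by rewrite runs_build // -!cats1 /= build_runs_cat.
(* Deleting the first run makes the altered word start with [bar x] instead of [x]; its run lengths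
   do not depend on this letter. *)
have [y yA ->] : exists2 y, letter y &
    alter r s (build x (l :: rcons mid l')) = build y (cut l ++ mid ++ cut l').
  rewrite (alter_outer runsE) !alter_nseq build_runs_flatten -build_cat.
  rewrite [cut l]/cut; case: leqP => _ /=.
    by exists (bar x); first exact: letter_mirror.
  by exists x => //; case: leqP => _; rewrite /= cats0.
rewrite run_lengths_build // !all_cat !cut_gt0 mid_gt0 //.
Qed.

Lemma size_leq_sumn ls : all (leq 1) ls -> size ls <= sumn ls.
Proof. by elim: ls => //= l ls IHls /andP[? /IHls]; lia. Qed.

Lemma D_mirror w : word_over r s w -> D r s (mirror r s w) = D r s w.
Proof.
case/word_over_buildP=> x [ls [xA ls_gt0 ->]]; rewrite mirror_build.
have mxA := letter_mirror xA.
case: (seq_outer ls) ls_gt0 => [->|[l ->]|[l [mid [l' ->]]]] ls_gt0 //.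
  by move: ls_gt0; rewrite /= andbT => l_gt0; rewrite !D_build1.
by rewrite !D_build2.
Qed.

Lemma mirror_word_over w : word_over r s w -> word_over r s (mirror r s w).
Proof.
by case/word_over_buildP=> x [ls [xA _ ->]]; rewrite mirror_build word_over_build ?letter_mirror.
Qed.

Lemma Cinfty_mirror w : Cinfty r s w -> Cinfty r s (mirror r s w).
Proof.
move=> wC [|k]; first exact: mirror_word_over (wC 0).
by rewrite iterSr D_mirror ?(wC 0) // -iterSr.
Qed.

(** * The runs of a Kolakoski sequence *)

Section Kolakoski.

Variable z : nat -> nat.
Hypothesis z_kol : kolakoski r s z.

Lemma kol_letter i : letter (z i).
Proof. exact: z_kol.1. Qed.

Lemma kol_gt0 i : 0 < z i.
Proof. exact/(leq_trans r_gt0)/letter_ge/kol_letter. Qed.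

Lemma run_const k j : j < z k -> z (start z k + j) = z (start z k).
Proof. by case: (z_kol.2 k) => _ + _ _; apply. Qed.

Lemma run_next k : z (start z k.+1) = bar (z (start z k)).
Proof.
rewrite startS; apply: letter_neqE; try exact: kol_letter.
by case: (z_kol.2 k) => _ _ /eqP.
Qed.

Lemma start_ltS k : start z k < start z k.+1.
Proof. by rewrite startS -addn1 leq_add2l kol_gt0. Qed.

Lemma start_mono : {mono start z : k l / k <= l}.
Proof. by apply: leq_mono; apply: homo_ltn start_ltS; apply: ltn_trans. Qed.

Lemma start_addn k n : start z k + n <= start z (k + n).
Proof.
elim: n => [|n IHn]; first by rewrite !addn0.
by rewrite !addnS (leq_ltn_trans IHn) ?start_ltS.
Qed.

Lemma leq_start k : k <= start z k.
Proof. by apply: leq_trans (start_addn 0 k); rewrite leq_addl. Qed.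

Lemma run_at i : exists k, start z k <= i < start z k.+1.
Proof.
elim: i => [|i [k /andP[leki ltik]]].
  by exists 0; rewrite /start big_ord0 /= -/(start z 1) startS ltn_addl ?kol_gt0.
case: (ltnP i.+1 (start z k.+1)) => [lti|gei].
  by exists k; rewrite lti (leq_trans leki).
exists k.+1; have -> : i.+1 = start z k.+1 by lia.
by rewrite leqnn start_ltS.
Qed.

(** * Aperiodicity *)

(** Of the runs [n] and [n.+1], one consists of the letter [s]. *)
Lemma letter_s_recurs n : exists2 k, n <= k & z k = s.
Proof.
have := letter_mirror_neq (kol_letter (start z n)); rewrite -run_next.
have /orP[/eqP->|/eqP zs _] := kol_letter (start z n); last by exists (start z n); first exact: leq_start.
have /orP[/eqP->|/eqP zs _] := kol_letter (start z n.+1); first by rewrite eqxx.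
by exists (start z n.+1); rewrite // (leq_trans _ (leq_start n.+1)).
Qed.

Lemma not_periodic q m : 0 < q -> ~ (forall i, m <= i -> z (i + q) = z i).
Proof.
have [n] := ubnP q; elim: n q m => // n IHn q m lt_qn q_gt0 zq.
(* Starting from [m.+1] keeps even the letter just before run [k] in the periodic range. *)
have [k ltmk zks] := letter_s_recurs m.+1.
have le_k := leq_start k.
(* If [start z k + q] were not the start of a run, it would carry the same letter as its
   predecessor; shifting back by [q], run [k] could be extended to the left. *)
have [k' start_k'] : exists k', start z k' = start z k + q.
  have [k' /andP[le_k' lt_k']] := run_at (start z k + q); exists k'.
  apply/eqP; rewrite eqn_leq le_k' leqNgt; apply/negP => lt_k'k.
  have [_ _ _] := z_kol.2 k; case; first by rewrite -/(start z k); lia.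
  have Ek j : start z k' <= j < start z k'.+1 -> z j = z (start z k').
    by rewrite startS => /andP[le_j lt_j]; rewrite -(subnKC le_j) run_const //; lia.
  rewrite -/(start z k) -[LHS]zq; last by lia.
  by rewrite -[RHS]zq ?Ek //; lia.
have lt_kk' : k < k'.
  by rewrite ltnNge -start_mono start_k' -ltnNge -addn1 leq_add2l.
(* Of two runs starting [q] apart, a shorter one would be followed by a change of letter where the
   other still continues. *)
have step j : start z (k' + j) = start z (k + j) + q ->
    z (k' + j) = z (k + j).
  move=> startE; have le_mj : m <= start z (k + j).
    by rewrite (leq_trans (ltnW ltmk)) // (leq_trans le_k) // start_mono leq_addr.
  have [_ c1 d1 _] := z_kol.2 (k + j); have [_ c2 d2 _] := z_kol.2 (k' + j).
  move: c1 d1 c2 d2; rewrite -!/(start z _) startE zq // => c1 d1 c2 d2.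
  have sh i : z (start z (k + j) + q + i) = z (start z (k + j) + i).
    by rewrite addnAC zq // (leq_trans le_mj) ?leq_addr.
  case: (ltngtP (z (k' + j)) (z (k + j))) => // lt_z.
    by case: d2; rewrite sh c1.
  by case: d1; rewrite -sh c2.
have startE j : start z (k' + j) = start z (k + j) + q.
  elim: j => [|j IHj]; first by rewrite !addn0.
  by rewrite !addnS !startS step // IHj addnAC.
apply: (IHn (k' - k) k); last first.
- move=> i le_ki; have := step (i - k) (startE _).
  by rewrite subnKC // => <-; congr z; lia.
- by rewrite subn_gt0.
(* Run [k] takes up [s > 1] of the [q] letters and each later run at least one, so [k' - k < q]. *)
have := start_addn k.+1 (k' - k.+1); rewrite subnKC // start_k' startS zks.
lia.
Qed.

Lemma kolakoski_aperiodic : ~ eventually_periodic z.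
Proof.
case=> m [[|q] [// _ zq]]; apply: (@not_periodic q.+1 m) => // i /zq.
by rewrite !factorS => -[->].
Qed.

(** * Factors of the sequence and their derivatives *)

Lemma factor_run k d l : d + l <= z k -> factor z (start z k + d) l = nseq l (z (start z k)).
Proof.
move=> le_k; apply: factor_const => j lt_jl.
by rewrite -addnA run_const //; lia.
Qed.

Lemma factor_runs k n :
  factor z (start z k) (start z (k + n) - start z k) = build (z (start z k)) (factor z k n).
Proof.
elim: n k => [|n IHn] k; first by rewrite addn0 subnn.
rewrite factorS /= -run_next -IHn addSnnS.
have -> : start z (k + n.+1) - start z k = z k + (start z (k + n.+1) - start z k.+1).
  have : start z k.+1 <= start z (k + n.+1) by rewrite start_mono; lia.
  by rewrite startS; lia.
by rewrite factorD -startS -{1}[start z k]addn0 factor_run.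
Qed.

Lemma flip_run k n : flip n (z (start z k)) = z (start z (k + n)).
Proof. by elim: n => [|n IHn]; rewrite ?addn0 // addnS run_next /= IHn. Qed.

(** Only the outer runs of a factor may be incomplete. This is used in both directions: to
    differentiate a factor, and to recover a word from an occurrence of its derivative. *)
Lemma factor_outer k n l l' : l <= z k -> l' <= z (k.+1 + n) ->
  factor z (start z k.+1 - l) (l + (start z (k.+1 + n) - start z k.+1) + l') =
  build (z (start z k)) (l :: rcons (factor z k.+1 n) l').
Proof.
move=> le_l le_l'.
have le_start : start z k.+1 <= start z (k.+1 + n) by rewrite start_mono leq_addr.
have lt_start := start_ltS k.
rewrite !factorD -cats1 /= build_cat /= size_factor cats0 -run_next flip_run catA.
have -> : start z k.+1 - l + l = start z k.+1 by move: lt_start; rewrite startS; lia.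
have -> : start z k.+1 - l + (l + (start z (k.+1 + n) - start z k.+1)) =
    start z (k.+1 + n) + 0 by move: lt_start; rewrite startS in le_start *; lia.
rewrite factor_runs factor_run // startS -addnBA // factor_run //; lia.
Qed.

Lemma factor_D i n : occurs z (D r s (factor z i n)).
Proof.
have occurs_nil : occurs z [::] by exists 0.
have [->|n_gt0] := posnP n; first by [].
have [k /andP[le_k lt_k]] := run_at i.
have [k' /andP[le_k' lt_k']] := run_at (i + n).-1.
have xA := kol_letter (start z k).
case: (ltngtP k k') => [lt_kk'|lt_k'k|eq_kk'].
- have le_starts : start z k.+1 <= start z k' by rewrite start_mono.
  pose l := start z k.+1 - i; pose l' := i + n - start z k'.
  have le_l : 0 < l <= z k by rewrite /l; move: lt_k; rewrite startS; lia.
  have le_l' : 0 < l' <= z k' by rewrite /l'; move: lt_k'; rewrite startS; lia.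
  have k'E : k' = k.+1 + (k' - k.+1) by rewrite subnKC.
  have -> : factor z i n =
      build (z (start z k)) (l :: rcons (factor z k.+1 (k' - k.+1)) l').
    rewrite -factor_outer -?k'E; [|by case/andP: le_l|by case/andP: le_l'].
    by rewrite /l /l'; congr factor; lia.
  case/andP: le_l => l_gt0 le_l; case/andP: le_l' => l'_gt0 le_l'.
  rewrite D_build2 //; last first.
    rewrite /= all_rcons l_gt0 l'_gt0; apply/allP => _ /mapP[j _ ->].
    exact: kol_gt0.
  (* A piece of run [j] longer than [r] forces [z j = s], so extending it to length [s] restores the
     full run. *)
  have cutE j a : a <= z j -> cut a = [::] \/ cut a = [:: z j].
    rewrite /cut => le_a; case: leqP => [_|lt_ra]; [by left | right].
    rewrite (leq_trans le_a) ?letter_le ?kol_letter //.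
    by have /orP[/eqP zr|/eqP->] := kol_letter j; first by lia.
  have [|] := cutE _ _ le_l' => ->; rewrite ?cats0.
    have [|] := cutE _ _ le_l => ->; first by exists k.+1; rewrite /occurs_at size_factor.
    by exists k; rewrite /occurs_at /= size_factor factorS.
  have -> : factor z k.+1 (k' - k.+1) ++ [:: z k'] = factor z k.+1 (k' - k.+1 + 1).
    by rewrite factorD -k'E.
  have [|] := cutE _ _ le_l => ->; first by exists k.+1; rewrite /occurs_at size_factor.
  by exists k; rewrite /occurs_at /= size_factor factorS.
- have : start z k'.+1 <= start z k by rewrite start_mono.
  by lia.
subst k'; rewrite -(subnKC le_k) factor_run; last by move: lt_k'; rewrite startS; lia.
(* The factor lies inside run [k], so [n <= z k <= s]; its derivative is nonempty only if
   [n = z k = s]. *)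
have -> : nseq n (z (start z k)) = build (z (start z k)) [:: n] by rewrite /= cats0.
rewrite D_build1 //; case: ltnP => // le_sn; exists k; rewrite /occurs_at /factor /=.
have := letter_le (kol_letter k); move: lt_k'; rewrite startS => ? ?.
by congr [:: _]; lia.
Qed.

Lemma word_over_factor i n : word_over r s (factor z i n).
Proof. by apply/allP => _ /mapP[j _ ->]; apply: kol_letter. Qed.

Lemma occurs_D w : occurs z w -> occurs z (D r s w).
Proof. by move=> [i zi]; have := factor_D i (size w); rewrite zi. Qed.

Lemma occurs_Cinfty w : occurs z w -> Cinfty r s w.
Proof.
move=> w_occ k; have [i zi] : occurs z (iter k (D r s) w).
  by elim: k => //= k; apply: occurs_D.
by rewrite -zi word_over_factor.
Qed.

(** * Mirror invariance implies recurrence *)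

Section MirrorInvariant.

Hypothesis z_mirror : mirror_invariant r s z.

(** A nonempty prefix and its mirror differ in the first letter, which excludes position 0; hence
    the length [n.+1]. *)
Lemma mirror_prefix n : exists2 i, 0 < i & occurs_at z (mirror r s (factor z 0 n.+1)) i.
Proof.
have [|[|i] zi] := (z_mirror (word_over_factor 0 n.+1)).1.
- by exists 0; rewrite /occurs_at size_factor.
- have := letter_mirror_neq (kol_letter 0); move: zi.
  by rewrite /occurs_at /mirror size_map size_factor /= => -[<- _]; rewrite eqxx.
by exists i.+1.
Qed.

Lemma prefix_recurs n : exists2 j, 0 < j & occurs_at z (factor z 0 n) j.
Proof.
have [i i_gt0 zi] := mirror_prefix n.
have [j j_gt0 zj] := mirror_prefix (i + n.+1).
(* The prefix of length [N] contains the mirrored prefix at [i], so its own mirror, found at [j],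
   contains the original prefix at [j + i]. *)
pose N := (i + n.+1).+1; exists (j + i); first by rewrite addn_gt0 j_gt0.
have EN : factor z 0 N = factor z 0 i ++ mirror r s (factor z 0 n.+1) ++ [:: z (i + n.+1)].
  by rewrite /N -addn1 !factorD; move: zi; rewrite /occurs_at size_map size_factor => ->; rewrite -catA.
move: zj; rewrite -/N EN /mirror !map_cat => /occurs_cat.
rewrite (mapK (mirror_letterK r s)) size_map size_factor.
rewrite -[n.+1]addn1 factorD => /(@occurs_cat z [::]).
by rewrite addn0.
Qed.

Lemma mirror_recurrent : recurrent z.
Proof.
move=> w [i0 wi0]; elim=> [|n [i le_ni wi]]; first by exists i0.
have [j j_gt0 zj] := prefix_recurs (i + size w).
exists (j + i); first by lia.
exact: occurs_at_prefix wi (leqnn _) zj.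
Qed.

(** * Every smooth word occurs in a mirror invariant sequence *)

(** The two words are equal or mirrors of each other, so only run lengths matter for occurrence. *)
Lemma build_occurs_bar x y ls :
  letter x -> letter y -> occurs z (build y ls) -> occurs z (build x ls).
Proof.
move=> xA yA; have [->|xDy] := eqVneq x y; first by [].
rewrite (letter_neqE xA yA xDy) -mirror_build => /z_mirror; apply.
exact: word_over_build.
Qed.

Lemma Cinfty_occurs w : Cinfty r s w -> occurs z w.
Proof.
have [n] := ubnP (size w); elim: n w => // n IHn w lt_wn wC.
have DwC : Cinfty r s (D r s w) by move=> k; rewrite -iterSr.
have [x [ls [xA ls_gt0 wE]]] := word_over_buildP (wC 0); rewrite /= in wE; subst w.
case: (seq_outer ls) ls_gt0 => [lsE|[l lsE]|[l [mid [l' lsE]]]] ls_gt0;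
  subst ls; first by exists 0.
- have l_gt0 : 0 < l by move: ls_gt0; rewrite /= andbT.
  have le_ls : l <= s.
    by have := wC 1; rewrite /= D_build1 //; case: ltnP => /= [/ltnW|_ /andP[/letter_le]].
  (* A single run of length at most [s] fits into any run of length [s]. *)
  have [k _ zk] := letter_s_recurs 0.
  apply: (build_occurs_bar xA (kol_letter (start z k))); exists (start z k).
  by rewrite /occurs_at size_build /= addn0 cats0 -{1}[start z k]addn0 factor_run ?zk.
move: DwC; rewrite D_build2 // => DwC.
have /and3P[l_gt0 l'_gt0 mid_gt0] : [&& 0 < l, 0 < l' & all (leq 1) mid].
  by move: ls_gt0; rewrite /= all_rcons.
have [|i0 Di0] := IHn _ _ DwC.
  move: lt_wn; rewrite size_build /= sumn_rcons !size_cat.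
  have := size_leq_sumn mid_gt0; have := size_cut l_gt0; have := size_cut l'_gt0.
  by lia.
(* If the first run was deleted, it has to fit into the run before run [i], so [i] must be
   positive. *)
have [i i_gt0 Di] := mirror_recurrent (ex_intro _ i0 Di0) 1.
have [k [le_l midE le_l']] : exists k, [/\ l <= z k,
    mid = factor z k.+1 (size mid) & l' <= z (k.+1 + size mid)].
  (* An outer run longer than [s] would put a number outside the alphabet into the derivative. *)
  have cutP a : word_over r s (cut a) ->
      a <= r /\ cut a = [::] \/ a <= s /\ cut a = [:: s].
    rewrite /cut; case: leqP => _ /=; first by left.
    by case: leqP => [|lt_sa] /=; [right | rewrite andbT => /letter_le; rewrite leqNgt lt_sa].
  have le_r a j : a <= r -> a <= z j.
    by move=> le_a; apply/(leq_trans le_a)/letter_ge/kol_letter.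
  have /and3P[lA _ l'A] : [&& word_over r s (cut l), word_over r s mid & word_over r s (cut l')].
    by have := DwC 0; rewrite /word_over /= !all_cat.
  have l'P k : occurs_at z (mid ++ cut l') k ->
      mid = factor z k (size mid) /\ l' <= z (k + size mid).
    move=> zk; have := occurs_cat (zk : occurs_at z ([::] ++ _) _).
    rewrite addn0 => {1}<-; split=> //.
    case: (cutP _ l'A) zk => [[/le_r-> //]|[le_s ->]].
    by rewrite -[[:: s]]cats0 => /occurs_cat [->].
  (* A deleted first run is placed in run [i.-1], an extended one in run [i], whose length is
     [s]. *)
  case: (cutP _ lA) Di => [[le_lr ->]|[le_ls ->]] /= zi.
    case: i i_gt0 zi => // i _ /l'P[midE le_l'].
    by exists i; split; first exact: le_r.
  exists i; move: zi; rewrite /occurs_at /= factorS => -[zs /l'P[midE le_l']].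
  by rewrite zs.
apply: (build_occurs_bar xA (kol_letter (start z k))).
exists (start z k.+1 - l); rewrite /occurs_at.
by have := factor_outer le_l le_l'; rewrite -midE => <-; rewrite size_factor.
Qed.

End MirrorInvariant.

End Kolakoski.

End TwoLetters.

Theorem mainTheorem1 (r s : nat) (r_gt0 : 0 < r) (r_lt_s : r < s)
    (z : nat -> nat) (z_kol : kolakoski r s z) :
  [/\ ~ eventually_periodic z,
      mirror_invariant r s z -> recurrent z &
      mirror_invariant r s z <->
        (forall w : seq nat, Cinfty r s w -> occurs z w)].
Proof.
split; first exact: kolakoski_aperiodic z_kol.
  exact: mirror_recurrent.
split=> [z_mirror w|all_occur w w_over]; first exact: Cinfty_occurs.
split=> w_occ; [|rewrite -[w](mirrorK r s)];
  exact/all_occur/(Cinfty_mirror r_gt0 r_lt_s)/(occurs_Cinfty r_gt0 r_lt_s z_kol).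
Qed.
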